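(* Each of the Szegő matrices $R,\mathcal R,S,\mathcal S$ is a banded matrix with $p+q+1$ diagonals, with $q$ superdiagonals and $p$ subdiagonals; that is, its $(i,j)$ entry vanishes whenever $j-i>q$ or $i-j>p$.
   Context: Let $p,q\in\mathbb N$ and let $\mu$ be a $q\times p$ matrix of complex Borel measures with infinite support on the unit circle $\mathbb T=\{|z|=1\}$. Rows and columns of semi-infinite matrices are indexed from $0$. For $r\in\mathbb N$, $Z_{[r]}(z)$ is the $\infty\times r$ matrix obtained by stacking the $r\times r$ blocks $I_r, z^{-1}I_r, zI_r, z^{-2}I_r, z^2I_r,\dots$ (block number $2N$ is $z^NI_r$, block number $2N+1$ is $z^{-N-1}I_r$). The left and right moment matrices are $$M=\oint_{\mathbb T}Z_{[q]}(z)\,\mathrm d\mu(z)\,Z_{[p]}^\top(z^{-1}),\qquad \mathcal M=\oint_{\mathbb T}Z_{[q]}(z^{-1})\,\mathrm d\mu(z)\,Z_{[p]}^\top(z).$$ It is assumed that they have Gauss--Borel factorizations $M=L^{-1}\bar U^{-1}$ and $\mathcal M=\bar{\mathcal L}^{-1}\mathcal U^{-1}$, with $L,\mathcal L$ lower triangular and $U,\mathcal U$ upper triangular semi-infinite matrices with nonzero diagonal entries (bar = entrywise complex conjugation). For $r\in\mathbb N$, with $r\times r$ blocks indexed from $0$: $\eta_{[r]}$ is the semi-infinite block permutation matrix fixing block $0$ and swapping blocks $2k+1\leftrightarrow 2k+2$ ($k\ge0$); $\nu_{[r]}$ is the semi-infinite block permutation matrix swapping blocks $2k\leftrightarrow2k+1$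 ($k\ge0$). One has $\eta_{[q]}M=\mathcal M\eta_{[p]}$, $M\eta_{[p]}=\eta_{[q]}\mathcal M$, $\nu_{[q]}M=\mathcal M\nu_{[p]}$, $M\nu_{[p]}=\nu_{[q]}\mathcal M$, and the Szegő recurrence matrices are $$R=\bar{\mathcal L}\eta_{[q]}L^{-1}=\mathcal U^{-1}\eta_{[p]}\bar U,\quad \mathcal R=L\eta_{[q]}\bar{\mathcal L}^{-1}=\bar U^{-1}\eta_{[p]}\mathcal U,$$ $$S=L\nu_{[q]}\bar{\mathcal L}^{-1}=\bar U^{-1}\nu_{[p]}\mathcal U,\quad \mathcal S=\bar{\mathcal L}\nu_{[q]}L^{-1}=\mathcal U^{-1}\nu_{[p]}\bar U.$$ *)

(* Defs.v *)
From HB Require Import structures.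
From mathcomp Require Import all_boot all_order all_algebra.
From mathcomp Require Import all_classical all_reals all_analysis.
From mathcomp Require Import complex.

Set Implicit Arguments.
Unset Strict Implicit.
Unset Printing Implicit Defensive.

Import Order.TTheory GRing.Theory Num.Theory numFieldNormedType.Exports.

Local Open Scope classical_set_scope.
Local Open Scope complex_scope.
Local Open Scope ring_scope.

Section UnitCircle.
Variable R : realType.

(* [R[i]^o] is R[i] with the topology of its norm. *)
Definition unit_circle : set R[i]^o := [set z : R[i]^o | `|z| = 1].

Lemma unit_circle1 : 1 \in unit_circle.
Proof. by rewrite inE /unit_circle /= normr1. Qed.

Definition circle : Type := set_type unit_circle.

HB.instance Definition _ := Topological.on circle.
HB.instance Definition _ :=
  isPointed.Build circle (SigSub unit_circle1 : set_type unit_circle).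

Definition borel_circle := g_sigma_algebraType (@open circle).

Definition circle_val (z : borel_circle) : R[i] := set_val (z : circle).

End UnitCircle.

(* A complex measure is given by its real and imaginary parts, which are finite
   signed measures (library charges are finite-valued). *)
Record complex_measure d (T : measurableType d) (R : realType) := ComplexMeasure {
  cm_Re : {charge set T -> \bar R};
  cm_Im : {charge set T -> \bar R} }.

Section ComplexMeasure.
Context d (T : measurableType d) (R : realType).

Definition cm_val (mu : complex_measure T R) (A : set T) : R[i] :=
  fine (cm_Re mu A) +i* fine (cm_Im mu A).

(* The value does not depend on the Hahn decomposition that is chosen. *)
Definition charge_integral (nu : {charge set T -> \bar R}) (f : T -> R) : R :=
  let P := cid (Hahn_decomposition nu) in
  let N := cid (projT2 P) in
  (\int[jordan_pos (projT2 N)]_x f x) - (\int[jordan_neg (projT2 N)]_x f x).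

Definition cm_integral (mu : complex_measure T R) (f : T -> R[i]) : R[i] :=
  (charge_integral (cm_Re mu) (fun x => complex.Re (f x))
     - charge_integral (cm_Im mu) (fun x => complex.Im (f x)))
  +i* (charge_integral (cm_Re mu) (fun x => complex.Im (f x))
     + charge_integral (cm_Im mu) (fun x => complex.Re (f x))).

End ComplexMeasure.

Section CircleMeasure.
Variable R : realType.

Definition circle_measure := complex_measure (borel_circle R) R.

(* The support of the total variation |mu|: [|mu| U != 0] holds exactly when
   some measurable subset of U has nonzero measure. *)
Definition cm_support (mu : circle_measure) : set (circle R) :=
  [set z | forall U : set (circle R), open U -> U z ->
    exists A : set (borel_circle R),
      [/\ measurable A, A `<=` U & cm_val mu A != 0]].

Definition circle_integral (mu : circle_measure) (f : R[i] -> R[i]) : R[i] :=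
  cm_integral mu (fun z => f (circle_val z)).

End CircleMeasure.

(* Semi-infinite matrices. *)
Definition smx (C : Type) := nat -> nat -> C.

Section SemiInfinite.
Variable C : numClosedFieldType.
Implicit Types A B L U : smx C.

Definition smx1 : smx C := fun i j => (i == j)%:R.

(* Sum over the indices with a nonzero summand, which are finitely many in every
   product used here; the library sum is 0 when they are infinitely many. *)
Definition smul A B : smx C :=
  fun i j => \sum_(k \in [set: nat]) (A i k * B k j).

Definition sconj A : smx C := fun i j => ((A i j)^*)%R.

Definition is_sinv A B := smul A B = smx1 /\ smul B A = smx1.

(* For triangular A with nonzero diagonal entries, [is_sinv A B] has exactly one
   solution B, which is triangular of the same kind. *)
Definition sinv A : smx C := xget (fun _ _ => 0) [set B | is_sinv A B].

Definition slower A := forall i j : nat, (i < j)%N -> A i j = 0.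
Definition supper A := forall i j : nat, (j < i)%N -> A i j = 0.
Definition sdiag_neq0 A := forall i : nat, A i i != 0.

Definition left_gauss_borel (M L U : smx C) :=
  [/\ slower L, supper U, sdiag_neq0 L, sdiag_neq0 U &
      M = smul (sinv L) (sinv (sconj U))].

Definition right_gauss_borel (M L U : smx C) :=
  [/\ slower L, supper U, sdiag_neq0 L, sdiag_neq0 U &
      M = smul (sinv (sconj L)) (sinv U)].

(* At most [up] superdiagonals and [lo] subdiagonals. *)
Definition banded (lo up : nat) A :=
  forall i j : nat, (i + up < j)%N || (j + lo < i)%N -> A i j = 0.

(* The involution s of the block indices acts on the r x r blocks. *)
Definition block_perm_smx (r : nat) (s : nat -> nat) : smx C :=
  fun i j => ((j %/ r == s (i %/ r))%N && (j %% r == i %% r)%N)%:R.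

Definition eta_idx (k : nat) : nat :=
  if k == 0%N then 0%N else if odd k then k.+1 else k.-1.

Definition nu_idx (k : nat) : nat := if odd k then k.-1 else k.+1.

Definition eta (r : nat) : smx C := block_perm_smx r eta_idx.
Definition nu (r : nat) : smx C := block_perm_smx r nu_idx.

(* [L] and [cL] are the lower triangular factors of the left and right moment
   matrices; [q] is the block size. *)
Definition szegoR (q : nat) (L cL : smx C) : smx C :=
  smul (smul (sconj cL) (eta q)) (sinv L).
Definition szego_calR (q : nat) (L cL : smx C) : smx C :=
  smul (smul L (eta q)) (sinv (sconj cL)).
Definition szegoS (q : nat) (L cL : smx C) : smx C :=
  smul (smul L (nu q)) (sinv (sconj cL)).
Definition szego_calS (q : nat) (L cL : smx C) : smx C :=
  smul (smul (sconj cL) (nu q)) (sinv L).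

End SemiInfinite.

Section Moments.
Variable R : realType.

(* Block 2N of Z_[r] is z^N I_r and block 2N+1 is z^(-N-1) I_r. *)
Definition Z_exponent (k : nat) : int :=
  if odd k then - (k./2.+1)%:Z else (k./2)%:Z.

Definition Zvec (r : nat) (z : R[i]) (i : nat) (a : 'I_r) : R[i] :=
  if (i %% r == a)%N then z ^ Z_exponent (i %/ r) else 0.

Definition left_moment (q p : nat) (mu : 'M[circle_measure R]_(q, p)) :
    smx R[i] :=
  fun i j => \sum_(a < q) \sum_(b < p)
    circle_integral (mu a b) (fun z => Zvec z i a * Zvec z^-1 j b).

Definition right_moment (q p : nat) (mu : 'M[circle_measure R]_(q, p)) :
    smx R[i] :=
  fun i j => \sum_(a < q) \sum_(b < p)
    circle_integral (mu a b) (fun z => Zvec z^-1 i a * Zvec z j b).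

End Moments.

(* Main.v *)
(** Both Gauss-Borel factors are used: conjugating the identity
    [eta_q M = calM eta_p] by the triangular factors equates
    [(lower) * eta_q * (lower)] with [(upper) * eta_p * (upper)].  The first
    form has no more superdiagonals than [eta_q], namely [q], and the second no
    more subdiagonals than [eta_p], namely [p].  The intertwining identity comes
    from [eta] acting on the exponents of [Z] by [e |-> - e] and [nu] by
    [e |-> - 1 - e], so that the integrands on both sides agree pointwise. *)
Require Import Defs.
From mathcomp Require Import all_boot all_order all_algebra.
From mathcomp Require Import all_classical all_reals all_analysis.
From mathcomp Require Import complex.
From mathcomp Require Import zify.

Local Open Scope complex_scope.

Import Order.TTheory GRing.Theory Num.Theory.

(** * Products of semi-infinite matrices with finitely many superdiagonals or subdiagonals *)

Section SemiInfiniteAlgebra.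
Local Open Scope ring_scope.
Context {C : numClosedFieldType}.
Implicit Types A B D L U : smx C.

Definition strans A : smx C := fun i j => A j i.

(** Only superdiagonals are bounded here; a bound on subdiagonals is [upper_width] of the transpose,
    so each fact is proved once and then transposed. *)
Definition upper_width (c : nat) A :=
  forall i j : nat, (i + c < j)%N -> A i j = 0.

Lemma smxP A B : (forall i j, A i j = B i j) -> A = B.
Proof. by move=> AB; apply/funext => i; apply/funext => j. Qed.

Lemma smulE n A B i j :
  (forall k, (n <= k)%N -> A i k * B k j = 0) ->
  smul A B i j = \sum_(k < n) A i k * B k j.
Proof.
move=> AB0; rewrite (fsbig_ord _ n (fun k => A i k * B k j)).
apply/esym/fsbig_widen => // k [_ /= /negP]; rewrite -leqNgt.
exact: AB0.
Qed.

Lemma smul_strans A B : strans (smul A B) = smul (strans B) (strans A).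
Proof.
by apply: smxP => i j; apply: eq_fsbigr => k _; rewrite mulrC.
Qed.

Lemma strans_smx1 : strans (smx1 C) = smx1 C.
Proof. by apply: smxP => i j; rewrite /strans /smx1 eq_sym. Qed.

Lemma upper_widthE {c A} n B i j : upper_width c A -> (i + c < n)%N ->
  smul A B i j = \sum_(k < n) A i k * B k j.
Proof.
by move=> Ac icn; apply: smulE => k nk; rewrite Ac ?mul0r// (leq_trans icn).
Qed.

Lemma upper_width_smul a b A B :
  upper_width a A -> upper_width b B -> upper_width (a + b) (smul A B).
Proof.
move=> Aa Bb i j ij; rewrite (upper_widthE (i + a).+1 B i j Aa)//.
by rewrite big1// => k _; rewrite Bb ?mulr0//; have := ltn_ord k; lia.
Qed.

(** Associativity fails for general semi-infinite matrices. Here the rows of [A] and [B] have finite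
    support, so all sums are finite and can be exchanged, with [D] arbitrary. *)
Lemma smulA_upper a b A B D : upper_width a A -> upper_width b B ->
  smul A (smul B D) = smul (smul A B) D.
Proof.
move=> Aa Bb; apply: smxP => i j.
rewrite (upper_widthE (i + a).+1 _ i j Aa)//.
rewrite (upper_widthE (i + (a + b)).+1 _ i j (upper_width_smul _ _ _ _ Aa Bb))//.
transitivity (\sum_(k < (i + a).+1) \sum_(l < (i + (a + b)).+1)
    A i k * B k l * D l j).
  apply: eq_bigr => k _.
  rewrite (upper_widthE (i + (a + b)).+1 _ k j Bb); last first.
    by have := ltn_ord k; lia.
  by rewrite mulr_sumr; apply: eq_bigr => l _; rewrite mulrA.
rewrite exchange_big; apply: eq_bigr => l _ /=.
by rewrite (upper_widthE (i + a).+1 _ i l Aa)// mulr_suml.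
Qed.

Lemma smulA_lower a b A B D :
  upper_width a (strans B) -> upper_width b (strans D) ->
  smul A (smul B D) = smul (smul A B) D.
Proof.
(* A matrix is convertible to its double transpose, so comparing transposes is enough. *)
move=> Ba Db; apply: (congr1 strans (x := strans _) (y := strans _)).
by rewrite !smul_strans (smulA_upper b a).
Qed.

Lemma smul1x A : smul (smx1 C) A = A.
Proof.
apply: smxP => i j; rewrite (upper_widthE (c := 0) (A := smx1 C) i.+1); last 2 first.
- by move=> k l kl; rewrite /smx1 ltn_eqF//; lia.
- by rewrite addn0.
rewrite big_ord_recr/= /smx1 eqxx mul1r big1 ?add0r// => k _.
by rewrite gtn_eqF// mul0r.
Qed.

Lemma smulx1 A : smul A (smx1 C) = A.
Proof.
apply: (congr1 strans (x := strans _) (y := strans A)).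
by rewrite smul_strans strans_smx1 smul1x.
Qed.

Lemma slower_upper_width A : slower A <-> upper_width 0 A.
Proof. by split=> A0 i j ij; apply: A0; move: ij; rewrite addn0. Qed.

(** * Inverses of triangular matrices *)

Section LowerInverse.
Variable L : smx C.
Hypotheses (L_lower : slower L) (L_diag : sdiag_neq0 L).

Let L0 : upper_width 0 L := proj1 (slower_upper_width L) L_lower.

(* Forward substitution: row [i] is stationary from step [i.+1] on. *)
Fixpoint forward_subst (n : nat) : smx C :=
  if n is m.+1 then
    fun i j => ((i == j)%:R - \sum_(k < i) L i k * forward_subst m k j) / L i i
  else fun _ _ => 0.

Lemma forward_subst_stable m n i j : (i < m)%N -> (i < n)%N ->
  forward_subst m i j = forward_subst n i j.
Proof.
elim: m n i => [//|m IH] [//|n] i im jn /=.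
congr ((_ - _) / _); apply: eq_bigr => k _; congr (_ * _).
by apply: IH; have := ltn_ord k; lia.
Qed.

Definition lower_rinv : smx C := fun i j => forward_subst i.+1 i j.

Lemma smul_lower_rinv : smul L lower_rinv = smx1 C.
Proof.
apply: smxP => i j; rewrite (upper_widthE i.+1 _ i j L0) ?addn0//.
rewrite big_ord_recr/= {2}/lower_rinv /= mulrCA mulfV ?mulr1//.
apply/eqP; rewrite addrCA addrC -subr_eq0 addrK; apply/eqP.
(* Row [k] of [lower_rinv] is taken at step [k.+1], but the recursion for row [i] reads it at step
   [i]; both are past stabilization since [k < i]. *)
by rewrite -sumrB big1 // => k _; rewrite /lower_rinv (forward_subst_stable k.+1 i)
  ?subrr.
Qed.

(** By strong induction on the row: above the diagonal the earlier rows contribute nothing, which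
    leaves [L i i * B i j = 0]. As [B] is arbitrary, this also applies to the inverse chosen by
    [sinv]. *)
Lemma slower_rinv B : smul L B = smx1 C -> slower B.
Proof.
move=> LB i; have [n] := ubnP i; elim: n i => // n IH i iltn j ij.
have /(congr1 (fun A : smx C => A i j)) := LB.
rewrite (upper_widthE i.+1 _ i j L0) ?addn0// big_ord_recr/= big1 ?add0r.
  rewrite /smx1 ltn_eqF// => /eqP; rewrite mulf_eq0 (negPf (L_diag i)).
  by move/eqP.
move=> k _; rewrite IH ?mulr0//; have := ltn_ord k; lia.
Qed.

Lemma rinv_diag B : smul L B = smx1 C -> sdiag_neq0 B.
Proof.
move=> LB i; have /(congr1 (fun A : smx C => A i i)) := LB.
rewrite (upper_widthE i.+1 _ i i L0) ?addn0// big_ord_recr/= big1 ?add0r.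
  move=> LBii; apply/eqP => Bii; move/eqP: LBii.
  by rewrite Bii mulr0 /smx1 eqxx eq_sym oner_eq0.
by move=> k _; rewrite (slower_rinv B LB) ?mulr0.
Qed.

End LowerInverse.

Lemma lower_inverse L : slower L -> sdiag_neq0 L -> exists B, is_sinv L B.
Proof.
move=> Ll Ld; have LB := smul_lower_rinv L Ll Ld.
set B := lower_rinv L in LB; exists B; split=> //.
have Bl := slower_rinv L Ll Ld B LB.
have BD := smul_lower_rinv B Bl (rinv_diag L Ll Ld B LB).
(* [B] has a right inverse [D] of its own, and [D = (L B) D = L (B D) = L]; hence [B L = 1]. *)
suff <- : lower_rinv B = L by [].
rewrite -[LHS]smul1x -LB -[RHS]smulx1 -BD.
by apply/esym/(smulA_upper 0 0); apply/slower_upper_width.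
Qed.

(** Existence of an inverse rules out the default value of [xget], so [sinv L] is a true inverse,
    and any right inverse is lower triangular. *)
Lemma sinv_lower L : slower L -> sdiag_neq0 L ->
  is_sinv L (sinv L) /\ upper_width 0 (sinv L).
Proof.
move=> Ll Ld; have [B LB] := lower_inverse L Ll Ld.
have LI : is_sinv L (sinv L) by apply: (xgetPex _ (P := [set B | is_sinv L B])); exists B.
split=> //; apply/slower_upper_width/(slower_rinv L Ll Ld).
by case: LI.
Qed.

Lemma is_sinv_strans A B : is_sinv A B -> is_sinv (strans A) (strans B).
Proof.
by case=> AB BA; split; rewrite -?(smul_strans B A) -?(smul_strans A B) ?AB ?BA strans_smx1.
Qed.

Lemma sinv_upper U : supper U -> sdiag_neq0 U ->
  is_sinv U (sinv U) /\ upper_width 0 (strans (sinv U)).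
Proof.
move=> Uu Ud; have Tl : slower (strans U) by move=> i j; apply: Uu.
have Td : sdiag_neq0 (strans U) by move=> i; apply: Ud.
have [B /is_sinv_strans TB] := lower_inverse _ Tl Td.
have UI : is_sinv U (sinv U).
  by apply: (xgetPex _ (P := [set B | is_sinv U B])); exists (strans B).
split=> //; apply/slower_upper_width/(slower_rinv _ Tl Td).
by case: (is_sinv_strans _ _ UI).
Qed.

(** * Bandedness from an intertwining identity *)

Lemma banded_upper_width lo up A :
  upper_width up A -> upper_width lo (strans A) -> banded lo up A.
Proof. by move=> Au Al i j /orP[/Au|/Al]. Qed.

(** Multiplying [Q L' U' = X' V' P] by [X] on the left and by [U] on the right gives
    [X Q L' = V' P U]. Primed letters stand for inverses of triangular factors. *)
Lemma intertwined_banded p q X X' L' U U' V' P Q :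
  upper_width 0 X -> upper_width 0 X' -> upper_width 0 L' ->
  upper_width 0 (strans U) -> upper_width 0 (strans U') ->
  upper_width 0 (strans V') ->
  smul X X' = smx1 C -> smul U' U = smx1 C ->
  upper_width q Q -> upper_width p (strans P) ->
  smul Q (smul L' U') = smul (smul X' V') P ->
  banded p q (smul (smul X Q) L').
Proof.
move=> Xl X'l L'l Uu U'u V'u XX' U'U Qq Pp QP.
have QL'w := upper_width_smul q 0 _ _ Qq L'l.
have E : smul (smul X Q) L' = smul (smul V' P) U.
  (* The identity is inserted as [U' U]. Rebracketing uses row finiteness of the lower factors and
     of [Q], and column finiteness of the upper factors and of [P]. *)
  rewrite -(smulA_upper 0 q X Q L')// -[LHS]smulx1 -U'U (smulA_lower 0 0)//.
  rewrite -(smulA_upper 0 (q + 0) X _ U')// -(smulA_upper q 0 Q L' U')// QP.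
  by rewrite -(smulA_lower 0 p X' V' P)// (smulA_upper 0 0 X X')// XX' smul1x.
apply: banded_upper_width.
  rewrite -[q]addn0; apply: upper_width_smul => //.
  by rewrite -[q]add0n; apply: upper_width_smul.
rewrite E smul_strans -[p]add0n; apply: upper_width_smul => //.
by rewrite smul_strans -[p]addn0; apply: upper_width_smul.
Qed.

(** * Block permutation matrices and the involutions of block indices *)

Definition block_idx (r : nat) (s : nat -> nat) (i : nat) : nat :=
  (s (i %/ r) * r + i %% r)%N.

Section BlockPermutation.
Variables (r : nat) (s : nat -> nat).
Hypotheses (r_gt0 : (0 < r)%N) (sK : involutive s).
Hypothesis s_step : forall k, (s k <= k.+1)%N.

Lemma block_idx_div i : (block_idx r s i %/ r)%N = s (i %/ r).
Proof. by rewrite /block_idx divnMDl// (divn_small (ltn_pmod i r_gt0)) addn0. Qed.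

Lemma block_idx_mod i : (block_idx r s i %% r)%N = (i %% r)%N.
Proof. by rewrite /block_idx modnMDl modn_mod. Qed.

Lemma block_perm_smxE i j : block_perm_smx C r s i j = (j == block_idx r s i)%:R.
Proof.
rewrite /block_perm_smx; congr (_%:R); congr nat_of_bool; apply/andP/eqP => [[]|->].
  by move=> /eqP ij /eqP mij; rewrite /block_idx -ij -mij -divn_eq.
by rewrite block_idx_div block_idx_mod !eqxx.
Qed.

(** The permutation is an involution, so its matrix is symmetric and a bound on superdiagonals also
    bounds subdiagonals. *)
Lemma strans_block_perm : strans (block_perm_smx C r s) = block_perm_smx C r s.
Proof.
apply: smxP => i j; rewrite /strans /block_perm_smx (eq_sym (i %% r)%N).
by rewrite -(can2_eq sK sK) eq_sym.
Qed.

(** A block moves forward by at most one place and positions inside blocks are kept, so an index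
    grows by at most [r]. *)
Lemma upper_width_block_perm : upper_width r (block_perm_smx C r s).
Proof.
move=> i j ij; rewrite block_perm_smxE gtn_eqF//.
apply: leq_ltn_trans ij; rewrite /block_idx {3}(divn_eq i r) addnAC leq_add2r.
by rewrite -mulSnr leq_mul2r s_step orbT.
Qed.

Lemma block_perm_smul A i j :
  smul (block_perm_smx C r s) A i j = A (block_idx r s i) j.
Proof.
rewrite (smulE (block_idx r s i).+1) => [|k ik].
  rewrite big_ord_recr/= block_perm_smxE eqxx mul1r big1 ?add0r// => k _.
  by rewrite block_perm_smxE ltn_eqF ?mul0r.
by rewrite block_perm_smxE gtn_eqF ?mul0r.
Qed.

Lemma smul_block_perm A i j :
  smul A (block_perm_smx C r s) i j = A i (block_idx r s j).
Proof.
rewrite -[RHS](block_perm_smul (strans A) j i) -[in RHS]strans_block_perm.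
by rewrite -(smul_strans A).
Qed.

End BlockPermutation.

Lemma eta_idxK : involutive eta_idx.
Proof. by case=> [//|k]; rewrite /eta_idx /=; case: ifP; do ?case: ifP; lia. Qed.

Lemma eta_idx_step k : (eta_idx k <= k.+1)%N.
Proof. by rewrite /eta_idx; case: eqP => // _; case: ifP; lia. Qed.

Lemma nu_idxK : involutive nu_idx.
Proof. by move=> k; rewrite /nu_idx; case: ifP => /=; case: ifP; lia. Qed.

Lemma nu_idx_step k : (nu_idx k <= k.+1)%N.
Proof. by rewrite /nu_idx; case: ifP; lia. Qed.

Lemma slower_sconj A : slower A -> slower (sconj A).
Proof. by move=> Al i j ij; rewrite /sconj Al ?conjC0. Qed.

Lemma supper_sconj A : supper A -> supper (sconj A).
Proof. by move=> Au i j ij; rewrite /sconj Au ?conjC0. Qed.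

Lemma sdiag_neq0_sconj A : sdiag_neq0 A -> sdiag_neq0 (sconj A).
Proof. by move=> Ad i; rewrite /sconj conjC_eq0. Qed.

Lemma supper_upper_width A : supper A -> upper_width 0 (strans A).
Proof. by move=> Au; apply/slower_upper_width => i j; apply: Au. Qed.

(** Common form of the four cases: [M1] and [M2] are the two moment matrices in either order, and
    conjugations are absorbed into the factors. The last hypothesis is the intertwining identity,
    read entrywise. *)
Lemma gauss_borel_banded p q (s : nat -> nat) L1 U1 L2 U2 M1 M2 :
  (0 < p)%N -> (0 < q)%N -> involutive s -> (forall k, s k <= k.+1)%N ->
  slower L1 -> supper U1 -> sdiag_neq0 L1 -> sdiag_neq0 U1 ->
  slower L2 -> supper U2 -> sdiag_neq0 L2 -> sdiag_neq0 U2 ->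
  M1 = smul (sinv L1) (sinv U1) -> M2 = smul (sinv L2) (sinv U2) ->
  (forall i j, M1 (block_idx q s i) j = M2 i (block_idx p s j)) ->
  banded p q (smul (smul L2 (block_perm_smx C q s)) (sinv L1)).
Proof.
move=> p0 q0 sK ss L1l U1u L1d U1d L2l U2u L2d U2d M1E M2E M12.
have [[_ _] L1'] := sinv_lower _ L1l L1d.
have [[LL2 _] L2'] := sinv_lower _ L2l L2d.
have [[_ UU1] U1'] := sinv_upper _ U1u U1d.
have [_ U2'] := sinv_upper _ U2u U2d.
apply: (intertwined_banded p q L2 (sinv L2) (sinv L1) U1 (sinv U1) (sinv U2)
          (block_perm_smx C p s)) => //.
- exact/slower_upper_width.
- exact: supper_upper_width.
- exact: upper_width_block_perm.
- by rewrite strans_block_perm//; apply: upper_width_block_perm.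
- rewrite -M1E -M2E; apply: smxP => i j.
  by rewrite block_perm_smul// smul_block_perm.
Qed.

End SemiInfiniteAlgebra.

(** * Intertwining of the left and right moment matrices *)

Section MomentIntertwining.
Local Open Scope ring_scope.
Context {R : realType}.

Lemma circle_val_neq0 (z : borel_circle R) : circle_val z != 0.
Proof.
have z1 : `|circle_val z| = 1 by exact: (set_valP (z : circle R)).
by rewrite -normr_eq0 z1 oner_eq0.
Qed.

Lemma circle_integral_ext (m : circle_measure R) (f g : R[i] -> R[i]) :
  (forall z : R[i], z != 0 -> f z = g z) -> circle_integral m f = circle_integral m g.
Proof.
move=> fg; rewrite /circle_integral; congr cm_integral; apply/funext => z.
by rewrite fg// circle_val_neq0.
Qed.

(** Reflecting an exponent [e] to [c - e] turns [z ^ e] into [z ^ c * z^-1 ^ e]. *)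
Lemma Zvec_block_idx (s : nat -> nat) (c : int) r (z : R[i]) i (a : 'I_r) : z != 0 ->
  (forall k, Z_exponent (s k) = c - Z_exponent k) ->
  Zvec z (block_idx r s i) a = z ^ c * Zvec z^-1 i a.
Proof.
move=> z0 sc; have r0 : (0 < r)%N by case: r a => [[]|].
rewrite /Zvec block_idx_mod block_idx_div//; case: eqP => _; last by rewrite mulr0.
by rewrite sc exprz_inv expfzDr.
Qed.

Section Intertwining.
Variables (s : nat -> nat) (c : int).
Hypothesis sc : forall k, Z_exponent (s k) = c - Z_exponent k.
Variables (q p : nat) (mu : 'M[circle_measure R]_(q, p)).

(** Reflecting the row index or the column index produces the same scalar factor [z ^ c], so the
    integrands agree. *)
Lemma left_right_moment i j : left_moment mu (block_idx q s i) j =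
  right_moment mu i (block_idx p s j).
Proof.
apply: eq_bigr => a _; apply: eq_bigr => b _; apply: circle_integral_ext => z z0.
by rewrite !(Zvec_block_idx s c)// mulrCA mulrA.
Qed.

Lemma right_left_moment i j : right_moment mu (block_idx q s i) j =
  left_moment mu i (block_idx p s j).
Proof.
apply: eq_bigr => a _; apply: eq_bigr => b _; apply: circle_integral_ext => z z0.
by rewrite !(Zvec_block_idx s c) ?invr_eq0// invrK mulrCA mulrA.
Qed.

End Intertwining.

Lemma Z_exponent_double n : Z_exponent n.*2 = n%:Z.
Proof. by rewrite /Z_exponent odd_double doubleK. Qed.

Lemma Z_exponent_doubleS n : Z_exponent n.*2.+1 = - n.+1%:Z.
Proof. by rewrite /Z_exponent /= odd_double /= uphalf_double. Qed.

(** Blocks [2n+1] and [2n+2] carry the opposite exponents [-n-1] and [n+1]; the fixed block 0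
    carries 0. *)
Lemma Z_exponent_eta k : Z_exponent (eta_idx k) = 0 - Z_exponent k.
Proof.
rewrite -(odd_double_half k) /eta_idx; case: (odd k) => /=.
  rewrite odd_double /= add1n -doubleS.
  by rewrite Z_exponent_double Z_exponent_doubleS; lia.
rewrite add0n; case: k./2 => [//|n].
rewrite doubleS /= odd_double /= -doubleS.
by rewrite Z_exponent_double Z_exponent_doubleS; lia.
Qed.

(** The swapped blocks [2n] and [2n+1] carry [n] and [-n-1], which sum to -1. *)
Lemma Z_exponent_nu k : Z_exponent (nu_idx k) = -1 - Z_exponent k.
Proof.
rewrite -(odd_double_half k) /nu_idx; case: (odd k); rewrite ?add1n ?add0n /=.
  by rewrite odd_double /= Z_exponent_double Z_exponent_doubleS; lia.
by rewrite odd_double Z_exponent_double Z_exponent_doubleS; lia.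
Qed.

End MomentIntertwining.

Theorem proposition2p28 (R : realType) (p q : nat) (hp : (0 < p)%N) (hq : (0 < q)%N)
    (mu : 'M[circle_measure R]_(q, p))
    (hmu : forall (a : 'I_q) (b : 'I_p), infinite_set (cm_support (mu a b)))
    (L U cL cU : smx R[i])
    (hLU : left_gauss_borel (left_moment mu) L U)
    (hcLU : right_gauss_borel (right_moment mu) cL cU) :
  [/\ banded p q (szegoR q L cL), banded p q (szego_calR q L cL),
      banded p q (szegoS q L cL) & banded p q (szego_calS q L cL)].
Proof.
have [Ll Uu Ld Ud ME] := hLU; have [cLl cUu cLd cUd cME] := hcLU.
have Uu' := supper_sconj _ Uu; have Ud' := sdiag_neq0_sconj _ Ud.
have cLl' := slower_sconj _ cLl; have cLd' := sdiag_neq0_sconj _ cLd.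
(* The moment matrix whose lower factor is inverted plays [M1]: the left one in the first and last
   cases, the right one in the two middle cases. *)
split.
- exact: (gauss_borel_banded p q eta_idx L (sconj U) (sconj cL) cU _ _ hp hq
      eta_idxK eta_idx_step Ll Uu' Ld Ud' cLl' cUu cLd' cUd ME cME
      (left_right_moment _ _ Z_exponent_eta _ _ mu)).
- exact: (gauss_borel_banded p q eta_idx (sconj cL) cU L (sconj U) _ _ hp hq
      eta_idxK eta_idx_step cLl' cUu cLd' cUd Ll Uu' Ld Ud' cME ME
      (right_left_moment _ _ Z_exponent_eta _ _ mu)).
- exact: (gauss_borel_banded p q nu_idx (sconj cL) cU L (sconj U) _ _ hp hq
      nu_idxK nu_idx_step cLl' cUu cLd' cUd Ll Uu' Ld Ud' cME ME
      (right_left_moment _ _ Z_exponent_nu _ _ mu)).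
- exact: (gauss_borel_banded p q nu_idx L (sconj U) (sconj cL) cU _ _ hp hq
      nu_idxK nu_idx_step Ll Uu' Ld Ud' cLl' cUu cLd' cUd ME cME
      (left_right_moment _ _ Z_exponent_nu _ _ mu)).
Qed.
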